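(* Let $t>0$ and $t_2>t_1>0$ be integers. Then: (i) $\alpha$ and $\tau(t)$ are multiplicatively independent unless $t=2$; (ii) $\tau(t_1)$ and $\tau(t_2)$ are multiplicatively independent; (iii) $\alpha,\tau(t_1),\tau(t_2)$ are multiplicatively independent unless $t_1=2$, or $t_2=2$, or $(t_1,t_2)=(1,10)$; (iv) $\alpha,\sqrt5,\tau(t)$ are multiplicatively independent unless $t\in\{1,2,10\}$.
   Context: $\alpha=\frac{1+\sqrt5}{2}$, and for a positive integer $t$, $\tau(t)=\frac{\alpha^t+1}{\sqrt5}\in\mathbb{Q}(\sqrt5)$. Nonzero algebraic numbers $\gamma_1,\dots,\gamma_k$ are multiplicatively independent if $\gamma_1^{e_1}\cdots\gamma_k^{e_k}=1$ with $e_i\in\mathbb{Z}$ implies $e_1=\dots=e_k=0$. *)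

(* Defs.v *)
(* MathComp development over algC, the field of algebraic numbers. *)
From mathcomp Require Import all_boot all_order all_algebra all_field.

Set Implicit Arguments.
Unset Strict Implicit.
Unset Printing Implicit Defensive.

Import GRing.Theory Num.Theory.
Local Open Scope ring_scope.

(* sqrtC returns the nonnegative root, so this fixes the usual real embedding
   of Q(sqrt 5) in algC. *)
Definition sqrt5 : algC := sqrtC 5%:R.

Definition alpha : algC := (1 + sqrt5) / 2%:R.

Definition tau (t : nat) : algC := (alpha ^+ t + 1) / sqrt5.

(* The nonzeroness clause cannot be dropped: as 0 ^- n = 0 in algC, the
   one-term family 0 satisfies the second clause. *)
Definition mult_indep (k : nat) (g : k.-tuple algC) : Prop :=
  (forall i : 'I_k, tnth g i != 0) /\
  (forall e : 'I_k -> int,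
     \prod_(i < k) tnth g i ^ e i = 1 -> forall i : 'I_k, e i = 0).

(* Main.v *)
(** Taking norms from Q(sqrt 5) kills [alpha] and turns [tau t] into
    [M t / 5] up to sign, where [M t] is the norm of [alpha ^ t + 1] up to sign,
    so everything reduces to the prime factorizations of the integers [M t].
    Suppose that [t1 < t2] and that every prime [p != 5] dividing [M t2] divides
    [M t1].  Modulo a prime above [p] both [alpha ^ t1] and [alpha ^ t2] (or
    conjugates) are -1, hence [p] divides [M g] for [g = gcd t1 t2], and [t2 / g]
    is odd if [p != 2].  For a prime [q] dividing [t2 / g] the quotient
    [M t2 / M (t2 / q)] is then a power of [q], and lifting the exponent shows
    that it divides [q ^ 2].  As [M] grows exponentially, only [t2 = 2, 6, 10]
    survive. *)
Require Import Defs.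
From mathcomp Require Import all_boot all_order all_algebra all_field.
From mathcomp Require Import zify ring.

Set Implicit Arguments.
Unset Strict Implicit.
Unset Printing Implicit Defensive.

Import Order.TTheory GRing.Theory Num.Theory.

(** * Growth of Fibonacci and Lucas numbers *)

Definition fib (n : nat) : nat := (iter n (fun p => (p.2, p.1 + p.2)) (0, 1)).1.

Definition lucas (n : nat) : nat :=
  (iter n (fun p => (p.2, p.1 + p.2)) (2, 1)).1.

(* The absolute value of the norm of [alpha ^+ t + 1]. *)
Definition anorm (t : nat) : nat := lucas t + (~~ odd t).*2.

Lemma fibSS n : fib n.+2 = fib n + fib n.+1.
Proof. by []. Qed.

Lemma lucasSS n : lucas n.+2 = lucas n + lucas n.+1.
Proof. by []. Qed.

Lemma fib_gt0 n : 0 < fib n.+1.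
Proof.
suff: (0 < fib n.+1) && (0 < fib n.+2) by case/andP.
by elim: n => // n /andP[h1 h2]; rewrite h2 fibSS addn_gt0 h1.
Qed.

Lemma lucas_fib n : lucas n.+1 = fib n + fib n.+2.
Proof.
suff: lucas n.+1 = fib n + fib n.+2 /\ lucas n.+2 = fib n.+1 + fib n.+3.
  by case.
elim: n => // n [h1 h2]; split=> //.
rewrite lucasSS h1 h2 !fibSS; lia.
Qed.

(** Both sides obey the Fibonacci recurrence in [m], which leaves [m = 0] and [m = 1]; the latter,
    [lucas n <= lucas n.+1], fails for [n = 0]. *)
Lemma lucas_ge_fib m n : 0 < n -> fib m.+1 * lucas n <= lucas (m + n).
Proof.
move=> n0; have [] : fib m.+1 * lucas n <= lucas (m + n) /\
   fib m.+2 * lucas n <= lucas (m.+1 + n); last by [].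
elim: m => [|m [h1 h2]].
  split; first by rewrite mul1n.
  by rewrite mul1n add1n; case: n n0 => // n _; rewrite lucasSS leq_addl.
split=> //; rewrite fibSS 2!addSn lucasSS mulnDl -addSn; exact: leq_add.
Qed.

(** The threshold is the least one, as [fib 12 = 144 = 12 ^ 2]. *)
Lemma sqr_lt_fib n : 13 <= n -> n ^ 2 < fib n.
Proof.
suff h: 13 <= n -> n ^ 2 < fib n /\ n.+1 ^ 2 < fib n.+1 by move=> /h[].
elim: n => // n IHn; rewrite leq_eqVlt => /orP[/eqP <- //|hn].
have [h1 h2] := IHn hn; split=> //; rewrite fibSS; nia.
Qed.

Lemma anorm_gt0 t : 0 < anorm t.
Proof.
rewrite /anorm; case: t => // t.
by rewrite lucas_fib addn_gt0 addn_gt0 fib_gt0 orbT.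
Qed.

Lemma anorm_gt1 t : 1 < t -> 1 < anorm t.
Proof.
case: t => // [] [] // t _; rewrite /anorm lucas_fib.
by move: (fib_gt0 t) (fib_gt0 t.+2); lia.
Qed.

(** * Residues of [anorm] modulo small numbers *)

(* The residues are computed on small numbers, so that periods up to 24 can be
   checked by evaluation. *)
Definition lucas_res (m n : nat) : nat :=
  (iter n (fun p => (p.2, (p.1 + p.2) %% m)) (2 %% m, 1 %% m)).1.

Definition anorm_res (m n : nat) : nat := (lucas_res m n + (~~ odd n).*2) %% m.

Lemma lucas_res_iter m n :
  iter n (fun p => (p.2, (p.1 + p.2) %% m)) (2 %% m, 1 %% m) =
  (lucas n %% m, lucas n.+1 %% m).
Proof. by elim: n => // n IHn; rewrite iterS IHn lucasSS modnDm. Qed.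

Lemma anorm_resE m t : anorm t %% m = anorm_res m t.
Proof. by rewrite /anorm_res /lucas_res lucas_res_iter /= modnDml. Qed.

(** The hypotheses on [lucas_res] bring two consecutive residues back to their initial values, so
    [k] is a period of [lucas] modulo [m]; evenness of [k] preserves the parity term of [anorm]. *)
Lemma anorm_mod k m t : ~~ odd k ->
  lucas_res m k = 2 %% m -> lucas_res m k.+1 = 1 %% m ->
  anorm t %% m = anorm_res m (t %% k).
Proof.
move=> k2; rewrite /lucas_res !lucas_res_iter /= => h0 h1.
rewrite -anorm_resE [in LHS](divn_eq t k) addnC.
elim: (t %/ k) => [|j <-]; first by rewrite mul0n addn0.
have per n : lucas (n + k) %% m = lucas n %% m.
  suff: lucas (n + k) %% m = lucas n %% m /\
        lucas (n.+1 + k) %% m = lucas n.+1 %% m by case.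
  elim: n => // n [e1 e2]; split=> //.
  by rewrite !addSn !lucasSS -modnDm -addSn e1 e2 modnDm.
rewrite mulSn addnA addnAC /anorm -modnDml per modnDml.
by rewrite [odd (_ + k)]oddD (negbTE k2) addbF.
Qed.

Lemma anorm_residue (P : pred nat) (Q : pred nat) k m : 0 < k -> ~~ odd k ->
  lucas_res m k = 2 %% m -> lucas_res m k.+1 = 1 %% m ->
  all (fun r => P r ==> Q (anorm_res m r)) (iota 0 k) ->
  forall t, P (t %% k) -> Q (anorm t %% m).
Proof.
move=> k0 k2 h0 h1 /allP h t Pt; rewrite (anorm_mod t k2 h0 h1).
by apply: (implyP (h _ _)) => //; rewrite mem_iota /= ltn_mod.
Qed.

Lemma dvdn2_anorm t : (2 %| anorm t) = (3 %| t).
Proof.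
(* [lucas] has period 3 modulo 2; an even period is required, hence 6. *)
have -> : (3 %| t) = (3 %| t %% 6) by rewrite /dvdn modn_dvdm.
rewrite /dvdn; apply/idP/idP.
  apply: contraTT; exact: (@anorm_residue
     (fun r => r %% 3 != 0) (fun r => r != 0) 6 2).
exact: (@anorm_residue (fun r => r %% 3 == 0) (fun r => r == 0) 6 2).
Qed.

Lemma dvdn5_anorm t : (5 %| anorm t) = (t %% 4 == 2).
Proof.
rewrite /dvdn; apply/idP/idP.
  apply: contraTT; exact: (@anorm_residue
     (fun r => r != 2) (fun r => r != 0) 4 5).
exact: (@anorm_residue (fun r => r == 2) (fun r => r == 0) 4 5).
Qed.

Lemma ndvdn8_anorm t : ~~ (8 %| anorm t).
Proof. exact: (@anorm_residue predT (fun r => r != 0) 12 8). Qed.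

(** Serves the lifting at [q = 3], where a single factor 3 is too little. The check runs over the
    period 24 modulo 9. *)
Lemma dvdn3_anorm t : 3 %| anorm t -> 9 %| anorm t.
Proof.
have : (anorm t %% 9) %% 3 == 0 -> anorm t %% 9 == 0.
  have := @anorm_residue predT
    (fun r => (r %% 3 == 0) ==> (r == 0)) 24 9.
  by move=> /(_ isT isT erefl erefl isT t isT) /implyP.
by rewrite modn_dvdm.
Qed.

(* Only the nine pairs with [q.-1 * g < 12] escape the general growth
   estimate. *)
Lemma anorm_small q g : prime q -> odd q -> 0 < g ->
  anorm (q * g) <= q ^ 2 * anorm g ->
  (q, g) \in [:: (3, 1); (3, 2); (5, 1); (5, 2); (7, 1)].
Proof.
move=> q_pr q_odd g0 hle.
have q1 := prime_gt1 q_pr.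
case: (leqP 12 (q.-1 * g)) => hqg.
  (* Here [(q.-1 * g).+1 >= 13], so the Fibonacci factor in the lower bound for [lucas (q * g)]
     exceeds the square of its index. *)
  have hL := lucas_ge_fib (q.-1 * g) g0.
  have hF := @sqr_lt_fib (q.-1 * g).+1 hqg.
  have eqg : q.-1 * g + g = q * g by rewrite addnC -mulSn prednK // ltnW.
  rewrite eqg in hL.
  have L1 : 0 < lucas g by case: (g) => // n; rewrite lucas_fib addn_gt0 fib_gt0 orbT.
  move: hle; rewrite leqNgt => /negP[]; apply: (@leq_trans (lucas (q * g))); last exact: leq_addr.
  have [g_odd|g_even] := boolP (odd g).
    rewrite /anorm g_odd addn0; apply: leq_trans hL.
    rewrite ltn_mul2r L1 /=; apply: leq_ltn_trans hF; rewrite leq_sqr; nia.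
  have g2 : 1 < g by case: (g) g_even g0 => // [] [].
  apply: leq_trans hL; rewrite /anorm g_even /=.
  have L3 : 2 < lucas g.
    case: (g) g2 => // [] [] // n _; rewrite lucas_fib.
    by move: (fib_gt0 n) (fib_gt0 n.+2); rewrite !fibSS; move: (fib_gt0 n); lia.
  (* For even [g], [anorm g = lucas g + 2 < 2 * lucas g], so a factor [2 * q ^ 2] suffices; [g >= 2]
     makes the index at least [q.*2 - 1]. *)
  have : 2 * q ^ 2 <= fib (q.-1 * g).+1.
    apply: leq_trans (ltnW hF).
    have : (q.*2 - 1) ^ 2 <= (q.-1 * g).+1 ^ 2 by rewrite leq_sqr; nia.
    by nia.
  by nia.
have q13 : q < 13 by nia.
have g6 : g < 6.
  have q3 : 2 < q by case: (q) q1 q_odd => // [] [|[]].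
  nia.
case: q q_pr q_odd q1 q13 hqg hle => // [] [|[|[|[|[|[|[|[|[|[|[|[|q]]]]]]]]]]]] //=;
  by case: g g0 g6 => // [] [|[|[|[|[|g]]]]].
Qed.

(** * Norms and their quotients, over any commutative ring *)

Section Conjugates.
Local Open Scope ring_scope.

(** Binet's formula, over a general ring so that it serves both in [algC] and in characteristic
    [p]. *)
Lemma lucasE (R : comNzRingType) (a b : R) n : a + b = 1 -> a * b = -1 ->
  (lucas n)%:R = a ^+ n + b ^+ n.
Proof.
move=> ab1 abN1.
suff [] : (lucas n)%:R = a ^+ n + b ^+ n /\
          (lucas n.+1)%:R = a ^+ n.+1 + b ^+ n.+1 by [].
elim: n => [|n [h1 h2]]; first by rewrite !expr0 !expr1 ab1.
split=> //; rewrite lucasSS natrD h1 h2 !exprS.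
have -> : b = 1 - a by rewrite -ab1; ring.
have {}abN1 : a * a = a + 1.
  by have -> : a * a = a * (a + b) - a * b by [ring]; rewrite ab1 abN1; ring.
have -> : (a * (a * a ^+ n)) = (a * a) * a ^+ n by rewrite mulrA.
have -> : (1 - a) * ((1 - a) * (1 - a) ^+ n) =
   (1 - a *+ 2 + a * a) * (1 - a) ^+ n by ring.
rewrite abN1; ring.
Qed.

Lemma anormE (R : comNzRingType) (a b : R) t : a + b = 1 -> a * b = -1 ->
  (anorm t)%:R = (a ^+ t + 1) * (b ^+ t + 1).
Proof.
move=> ab1 abN1; rewrite /anorm natrD (lucasE t ab1 abN1).
have -> : (a ^+ t + 1) * (b ^+ t + 1) = (a * b) ^+ t + (a ^+ t + b ^+ t) + 1.
  by rewrite exprMn; ring.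
by rewrite abN1 -signr_odd; case: (odd t); rewrite /= ?expr0 ?expr1 ?addn0 ?doubleS ?double0; ring.
Qed.

(** For odd [d] this is [(x ^+ d + 1) / (x + 1)], written as a sum so that it keeps its meaning at
    [x = -1], where it equals [d]. *)
Definition alt_geom (R : comNzRingType) (d : nat) (x : R) : R :=
  \sum_(i < d) (- x) ^+ i.

Lemma alt_geomE (R : comNzRingType) d (x : R) : odd d ->
  x ^+ d + 1 = (x + 1) * alt_geom d x.
Proof.
move=> d_odd; have := subrX1 (- x) d; rewrite exprNn -signr_odd d_odd expr1.
by move=> h; apply: oppr_inj; rewrite -mulNr !opprD -[RHS]h mulN1r.
Qed.

(** Reduction by [a * a = a + 1] is the same in every ring; having [c0] and [c1] chosen before [R]
    lets an identity found in [algC] be used in characteristic [p]. *)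
Lemma alt_geom_base (d n : nat) : exists c0 c1 : int,
  forall (R : comNzRingType) (a : R), a * a = a + 1 ->
    alt_geom d (a ^+ n) = c0%:~R + c1%:~R * a.
Proof.
have pow m : exists c0 c1 : int, forall (R : comNzRingType) (a : R),
    a * a = a + 1 -> a ^+ m = c0%:~R + c1%:~R * a.
  elim: m => [|m [c0 [c1 h]]]; first by exists 1, 0 => R a _; rewrite mul0r addr0.
  exists c1, (c0 + c1) => R a aa; rewrite exprSr (h _ _ aa) mulrDl -mulrA aa.
  by rewrite intrD; ring.
elim: d => [|d [c0 [c1 h]]].
  by exists 0, 0 => R a _; rewrite /alt_geom big_ord0 mul0r addr0.
have [e0 [e1 h']] := pow (n * d)%N.
exists (c0 + (-1) ^+ d * e0), (c1 + (-1) ^+ d * e1) => R a aa.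
have -> : alt_geom d.+1 (a ^+ n) = alt_geom d (a ^+ n) + (- a ^+ n) ^+ d.
  by rewrite /alt_geom big_ord_recr.
rewrite (h _ _ aa) [(- a ^+ n) ^+ d]exprNn -exprM (h' _ _ aa) !intrD !intrM.
rewrite rmorphXn /= rmorphN1; ring.
Qed.

Lemma sqr_sqrt5 : sqrt5 ^+ 2 = 5%:R.
Proof. exact: sqrtCK. Qed.

Lemma alpha_conj : alpha * (1 - alpha) = -1.
Proof.
have -> : alpha * (1 - alpha) = (1 - sqrt5 ^+ 2) / 4%:R by rewrite /alpha; field.
by rewrite sqr_sqrt5; field.
Qed.

Lemma anorm_quotient (d g : nat) : odd d -> exists Q : nat,
  anorm (d * g) = (anorm g * Q)%N /\
  forall (R : comNzRingType) (a b : R), a + b = 1 -> a * b = -1 ->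
    Q%:R = alt_geom d (a ^+ g) * alt_geom d (b ^+ g).
Proof.
move=> d_odd; have [c0 [c1 h]] := alt_geom_base d g.
(* The norm of [c0 + c1 * a] when [a + b = 1] and [a * b = -1]. *)
pose z : int := c0 * c0 + c0 * c1 - c1 * c1.
have hz (R : comNzRingType) (a b : R) : a + b = 1 -> a * b = -1 ->
    z%:~R = alt_geom d (a ^+ g) * alt_geom d (b ^+ g).
  move=> ab1 abN1.
  have eqb : b = 1 - a by rewrite -ab1; ring.
  have aa : a * a = a + 1.
    by have -> : a * a = a * (a + b) - a * b by [ring]; rewrite ab1 abN1; ring.
  have bb : b * b = b + 1.
    by have -> : b * b = b * (a + b) - a * b by [ring]; rewrite ab1 abN1; ring.
  rewrite (h _ _ aa) (h _ _ bb) /z intrB intrD !intrM.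
  have -> : (c0%:~R + c1%:~R * a) * (c0%:~R + c1%:~R * b) =
     c0%:~R * c0%:~R + c0%:~R * c1%:~R * (a + b) + c1%:~R * c1%:~R * (a * b) by ring.
  by rewrite ab1 abN1; ring.
have alphaD1 : alpha + (1 - alpha) = 1 by rewrite addrC subrK.
have hM : (anorm (d * g))%:Z = (anorm g)%:Z * z.
  apply: (@intr_inj algC); rewrite intrM -!pmulrn.
  rewrite !(anormE _ alphaD1 alpha_conj) (hz _ _ _ alphaD1 alpha_conj).
  rewrite ![(d * g)%N]mulnC !exprM !(alt_geomE _ d_odd); ring.
have z0 : 0 <= z.
  have : 0 < (anorm g)%:Z * z by rewrite -hM; move: (anorm_gt0 (d * g)); lia.
  rewrite pmulr_rgt0; first exact: ltW.
  by move: (anorm_gt0 g); lia.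
case: z z0 hz hM => // Q _ hz hM; exists Q; split; first by lia.
by move=> R a b ab1 abN1; rewrite -(hz _ _ _ ab1 abN1).
Qed.
End Conjugates.

(** * Prime divisors of [anorm t], seen in characteristic [p] *)

Section Residues.
Local Open Scope ring_scope.

(** [a] and [b] stand for [alpha] and its conjugate modulo a prime above [p]. *)
Lemma golden_field p : prime p -> exists (K : fieldType) (a b : K),
  [/\ p \in [pchar K], a + b = 1 & a * b = -1].
Proof.
move=> p_pr; have [K [f _]] := countable_algebraic_closure 'F_p.
have [a ha] := @solve_monicpoly K 2 (fun=> 1) isT.
exists K, a, (1 - a); split; last 2 first.
- by rewrite addrC subrK.
- move: ha; rewrite !big_ord_recl big_ord0 expr0 expr1 => ha.
  by rewrite mulrBr mulr1 -expr2 ha; ring.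
by rewrite (fmorph_pchar f) pchar_Fp.
Qed.

Lemma dvdn_anorm_field (K : fieldType) (a b : K) p t : p \in [pchar K] ->
  a + b = 1 -> a * b = -1 ->
  (p %| anorm t)%N = (a ^+ t == -1) || (b ^+ t == -1).
Proof.
move=> pK ab1 abN1; rewrite (dvdn_pcharf pK) (anormE t ab1 abN1) mulf_eq0.
by rewrite !addr_eq0.
Qed.

Lemma conj_expr_eqN1 (K : fieldType) (a b : K) t : a * b = -1 ->
  (b ^+ t == -1) = (a ^+ t == - (-1) ^+ t).
Proof.
move=> abN1.
have a0 : a ^+ t != 0.
  apply: expf_neq0; apply: contra_eq_neq abN1 => ->.
  by rewrite mul0r eq_sym oppr_eq0 oner_eq0.
rewrite -(inj_eq (mulfI a0)) -exprMn abN1 mulrN1.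
by rewrite -eqr_opp opprK eq_sym.
Qed.

(** Bezout gives [a ^+ gcdn m n = 1] or [-1]; in the first case [a ^+ m = 1] too, so [1 = -1] in
    [K]. *)
Lemma expr_gcdn_eqN1 (K : fieldType) (a : K) m n : (0 < m)%N ->
  a ^+ m = -1 -> a ^+ n = -1 -> a ^+ gcdn m n = -1.
Proof.
move=> m0 am an; set g := gcdn m n.
have [u v huv _] := egcdnP n m0.
have ag : a ^+ g = 1 \/ a ^+ g = -1.
  have : a ^+ (u * m) = a ^+ (v * n) * a ^+ g by rewrite huv exprD.
  rewrite ![(_ * m)%N]mulnC ![(_ * n)%N]mulnC !exprM am an.
  rewrite -signr_odd -[in RHS]signr_odd.
  case: (odd u); case: (odd v); rewrite ?expr0 ?expr1 ?mul1r ?mulN1r.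
  - by move/oppr_inj => <-; left.
  - by move=> <-; right.
  - by move=> h; right; rewrite h opprK.
  - by move=> <-; left.
case: ag => // ag; rewrite -[RHS]am.
by have /dvdnP[k ->] := dvdn_gcdl m n; rewrite mulnC exprM -/g ag expr1n.
Qed.

Lemma dvdn_anorm_gcd p t1 t2 : prime p -> (0 < t1)%N ->
  (p %| anorm t1)%N -> (p %| anorm t2)%N ->
  (p %| anorm (gcdn t1 t2))%N /\ (p != 2 -> odd (t2 %/ gcdn t1 t2))%N.
Proof.
move=> p_pr t10 h1 h2; have [K [a [b [pK ab1 abN1]]]] := golden_field p_pr.
wlog at2 : a b ab1 abN1 / a ^+ t2 = -1.
  move: h2; rewrite (dvdn_anorm_field _ pK ab1 abN1) => /orP[]/eqP e W.
    exact: (W a b).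
  by apply: (W b a) e; rewrite ?[b + a]addrC ?[b * a]mulrC.
have two0 : (1 == -1 :> K) = (p == 2)%N.
  rewrite -subr_eq0 opprK -(natrD _ 1 1) -(dvdn_pcharf pK).
  by rewrite dvdn_prime2.
have at1 : a ^+ t1 = -1.
  move: h1; rewrite (dvdn_anorm_field _ pK ab1 abN1) (conj_expr_eqN1 _ abN1).
  case/orP=> /eqP // e1.
  have [t1_odd|t1_even] := boolP (odd t1); last first.
    by rewrite e1 -signr_odd (negbTE t1_even).
  rewrite -signr_odd t1_odd expr1 opprK in e1.
  (* The two ways to evaluate this power give [1 = -1], so the exceptional case [a ^+ t1 = 1] is no
     exception. *)
  have : a ^+ (t1 * t2) = a ^+ (t2 * t1) by rewrite mulnC.
  by rewrite !exprM e1 at2 -signr_odd t1_odd expr1 expr1n.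
have ag := expr_gcdn_eqN1 t10 at1 at2.
split; first by rewrite (dvdn_anorm_field _ pK ab1 abN1) ag eqxx.
(* An even quotient would give [-1 = a ^+ t2 = 1], that is [p = 2]. *)
apply: contraR => d_even; rewrite -two0 -at2.
rewrite -[X in a ^+ X](divnK (dvdn_gcdr t1 t2)) mulnC exprM ag.
by rewrite -signr_odd (negbTE d_even).
Qed.

Lemma dvdn_anorm_oddmul p d g : odd d ->
  (p %| anorm g)%N -> (p %| anorm (d * g))%N.
Proof.
by move=> d_odd h; have [Q [-> _]] := anorm_quotient g d_odd; rewrite dvdn_mulr.
Qed.

(** When [a ^+ g = -1] in characteristic [p], the conjugate [b ^+ g] is 1 or -1, so the two factors
    of [Q] are [q] and one of 1 and [q]; hence [p] divides [q]. *)
Lemma dvdn_anorm_quotient p q g Q : prime p -> prime q -> odd q ->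
  (0 < g)%N -> anorm (q * g) = (anorm g * Q)%N ->
  (p %| anorm g)%N -> (p %| Q)%N -> p = q.
Proof.
move=> p_pr q_pr q_odd g0 eQ pg pQ.
have [Q' [eQ' hQ']] := anorm_quotient g q_odd.
have {eQ'} eQQ : Q' = Q.
  by apply/eqP; rewrite -(eqn_pmul2l (anorm_gt0 g)) -eQ' eQ.
rewrite {}eQQ in hQ'.
have [K [a [b [pK ab1 abN1]]]] := golden_field p_pr.
wlog ag : a b ab1 abN1 / a ^+ g = -1.
  move: pg; rewrite (dvdn_anorm_field _ pK ab1 abN1) => /orP[]/eqP e W.
    exact: (W a b).
  by apply: (W b a) e; rewrite ?[b + a]addrC ?[b * a]mulrC.
have geomN1 : alt_geom q (-1 : K) = q%:R.
  rewrite /alt_geom opprK (eq_bigr (fun=> 1)) => [|i _]; last exact: expr1n.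
  by rewrite sumr_const card_ord.
have geom1 : alt_geom q (1 : K) = 1.
  rewrite /alt_geom; elim: (q) (q_odd) => // n IHn; rewrite big_ord_recr /=.
  have : forall n, \sum_(i < n) (-1 : K) ^+ i = (odd n)%:R.
    elim=> [|m IHm]; first by rewrite big_ord0.
    by rewrite big_ord_recr /= IHm -signr_odd; case: (odd m); rewrite /= ?expr0 ?expr1 ?subrr ?add0r.
  by move=> -> n_even; rewrite -signr_odd (negbTE n_even) expr0 add0r.
have : q%:R == 0 :> K.
  move: pQ; rewrite (dvdn_pcharf pK) (hQ' _ _ _ ab1 abN1) ag geomN1 mulf_eq0.
  case/orP=> //.
  have : b ^+ g = - (-1) ^+ g.
    apply/eqP; rewrite -(conj_expr_eqN1 (a := b) (b := a)) ?ag //.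
    by rewrite mulrC.
  move=> ->; rewrite -signr_odd; case: (odd g); rewrite ?expr0 ?expr1 ?geomN1 //.
  by rewrite opprK geom1 oner_eq0.
by rewrite -(dvdn_pcharf pK) dvdn_prime2 // => /eqP.
Qed.

End Residues.

(** * Lifting the exponent with algebraic integers *)

Section Lifting.
Local Open Scope ring_scope.

(** Binomial expansion of [(Y + (X - Y)) ^+ q]: [q] divides the inner coefficients, and [w] collects
    the terms of degree 2 to [q.-1] in [X - Y]. *)
Lemma exprp_near (q : nat) (X Y : algC) : prime q ->
  X \in Aint -> Y \in Aint -> exists2 w, w \in Aint &
  X ^+ q = Y ^+ q + q%:R * (X - Y) * Y ^+ q.-1 + q%:R * (X - Y) ^+ 2 * w +
           (X - Y) ^+ q.
Proof.
move=> q_pr XA YA; set s := X - Y.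
have sA : s \in Aint by rewrite rpredB.
case: q q_pr => // [] [] // q q_pr.
exists (\sum_(i < q) ('C(q.+2, i.+2) %/ q.+2)%:R * (Y ^+ (q - i) * s ^+ i)).
  by apply: rpred_sum => i _; rewrite !rpredM ?rpredX ?rpred_nat.
have -> : X = Y + s by rewrite /s; ring.
rewrite exprDn big_ord_recl big_ord_recl big_ord_recr /= subn0 !bin0 bin1.
rewrite /bump /= !add1n subnn !expr0 expr1 binn subSS subn0 !mulr1 mul1r !mulr1n.
rewrite -(mulr_natl (_ * s)) [Y ^+ _ * s]mulrC -!addrA mulrA.
congr (_ + (_ + (_ + _))).
rewrite mulr_sumr; apply: eq_bigr => i _.
have qi : (q.+2 %| 'C(q.+2, i.+2))%N.
  by apply: prime_dvd_bin; rewrite ?q_pr //= !ltnS.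
rewrite -[in LHS](divnK qi) /bump /= !add1n !subSS -mulr_natl natrM !exprS expr0.
ring.
Qed.

(* With [s = X - Y], the quotient [R] is [q * (unit + multiple of s) modulo
   q ^+ 2], and [q] divides [s ^+ 2], so [R / q] is coprime to [q]. *)
Lemma geom_quotient_cube (q : nat) (X Y R : algC) : prime q ->
  X \in Aint -> Y \in Aint -> (X * Y) ^+ 2 = 1 -> X != Y ->
  X ^+ q - Y ^+ q = (X - Y) * R ->
  (X - Y) ^+ 2 / q%:R \in Aint -> (X - Y) ^+ q.-1 / q%:R ^+ 2 \in Aint ->
  R ^+ 2 / q%:R ^+ 3 \notin Aint.
Proof.
move=> q_pr XA YA XY1 neqXY; have [w wA ->] := exprp_near q_pr XA YA.
have : X - Y != 0 by rewrite subr_eq0.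
have : X - Y \in Aint by rewrite rpredB.
move: (X - Y) => s sA s0 hR hs hsq.
have q0 : q%:R != 0 :> algC by rewrite pnatr_eq0 -lt0n prime_gt0.
have qA : q%:R \in Aint by exact: rpred_nat.
set v := _ / _ in hsq.
have {}hR : R / q%:R = Y ^+ q.-1 + s * w + q%:R * v.
  apply: (mulfI s0); rewrite mulrA -hR /v.
  have -> : s ^+ q = s * s ^+ q.-1 by rewrite -exprS prednK ?prime_gt0.
  by field.
apply/negP => hz; set z := _ / _ in hz.
have {}hR : (Y ^+ q.-1 + s * w + q%:R * v) ^+ 2 = q%:R * z.
  by rewrite -hR /z; field.
clearbody v z.
have YqA : Y ^+ q.-1 \in Aint by rewrite rpredX.
have Y_unit : exists2 y', y' \in Aint & Y ^+ q.-1 * y' = 1.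
  exists ((X ^+ 2 * Y) ^+ q.-1); first by rewrite !(rpredX, rpredM).
  have eqXY : Y * (X ^+ 2 * Y) = (X * Y) ^+ 2 by ring.
  by rewrite -exprMn eqXY XY1 expr1n.
move: (Y ^+ q.-1) YqA Y_unit hR => y yA [y' y'A yy'] hR.
(* Chosen so that the square in [hR] expands to [y ^+ 2 + s * A + q%:R * B]; squaring once more
   turns [s] into a multiple of [q], so [q] divides a unit. *)
pose A := y * w *+ 2 + s * w ^+ 2.
pose B := y * v *+ 2 + s * w * v *+ 2 + q%:R * v ^+ 2.
have AA : A \in Aint by rewrite !(rpredD, rpredMn, rpredM, rpredX).
have BA : B \in Aint by rewrite !(rpredD, rpredMn, rpredM, rpredX).
have eqy : y ^+ 2 = q%:R * (z - B) - s * A.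
  by rewrite mulrBr -hR /A /B; ring.
clearbody A B.
have [u uA es] : exists2 u, u \in Aint & s ^+ 2 = q%:R * u.
  by exists (s ^+ 2 / q%:R) => //; field.
have zBA : z - B \in Aint by rewrite rpredB.
pose C := q%:R * (z - B) ^+ 2 - (z - B) * s * A *+ 2 + u * A ^+ 2.
have CA : C \in Aint.
  apply: rpredD; last by rewrite rpredM ?rpredX.
  by apply: rpredB; rewrite ?rpredMn ?rpredM ?rpredX.
have eqC : y ^+ 4 = q%:R * C.
  have -> : y ^+ 4 = y ^+ 2 * y ^+ 2 by rewrite -exprD.
  rewrite eqy; have -> : (q%:R * (z - B) - s * A) * (q%:R * (z - B) - s * A) =
    (q%:R * (z - B)) ^+ 2 - q%:R * (z - B) * s * A *+ 2 + s ^+ 2 * A ^+ 2 by ring.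
  by rewrite es /C; ring.
clearbody C.
have : q%:R^-1 \in Aint.
  suff -> : q%:R^-1 = C * y' ^+ 4 by apply: rpredM => //; apply: rpredX.
  by apply: (mulfI q0); rewrite divff // mulrA -eqC -exprMn yy' expr1n.
have qQ : q%:R^-1 \in Crat by rewrite rpredV rpred_nat.
move=> /(Cint_rat_Aint qQ) /intrP[m hm].
have : (q%:Z * m)%:~R = 1%:~R :> algC by rewrite intrM -hm mulrV ?unitfE.
move/intr_inj => /(congr1 absz) /eqP; rewrite abszM muln_eq1 => /andP[/eqP q1 _].
by move: q_pr; rewrite -[q]/(`|q%:Z|)%N q1.
Qed.

Lemma Aint_alpha : alpha \in Aint.
Proof.
pose p : {poly algC} := 'X ^+ 2 - ('X + 1%:P).
apply: (@root_monic_Aint p).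
- rewrite rootE /p !hornerE; apply/eqP.
  have -> : alpha ^+ 2 - (alpha + 1) = - (alpha * (1 - alpha)) - 1 by ring.
  by rewrite alpha_conj; ring.
- by rewrite monicE lead_coefDl ?lead_coefXn // size_polyN size_XaddC size_polyXn.
apply/polyOverP => i; rewrite /p coefB coefD coefXn coefX coefC.
by case: (i == 0%N); rewrite rpredB ?rpredD ?rpred_nat ?rpred1 ?rpred0.
Qed.

(** For odd [g], [X = a ^+ g] and [Y = - b ^+ g] have difference [anorm g] and quotient [R = Q]. For
    even [g], [anorm g] is the square of [a ^+ m + (-1) ^+ m * b ^+ m] with [m = g./2], and there
    [R ^+ 2 = Q]. *)
Lemma anorm_quotient_ncube q g Q : prime q -> odd q -> (0 < g)%N ->
  anorm (q * g) = (anorm g * Q)%N -> (q %| anorm g)%N -> ~~ (q ^ 3 %| Q)%N.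
Proof.
move=> q_pr q_odd g0 eQ qg.
set a := alpha; set b := 1 - alpha.
have ab1 : a + b = 1 by rewrite /b addrC subrK.
have abN1 : a * b = -1 := alpha_conj.
have aA : a \in Aint := Aint_alpha.
have bA : b \in Aint by rewrite rpredB ?rpred1.
have q0 : q%:R != 0 :> algC by rewrite pnatr_eq0 -lt0n prime_gt0.
have q3 : (2 < q)%N by move: q_odd (prime_gt1 q_pr); case: (q) => [|[|[]]].
have [k ek] := dvdnP qg.
have M0 : (anorm g)%:R != 0 :> algC by rewrite pnatr_eq0 -lt0n anorm_gt0.
apply/negP => /dvdnP[j ej].
have [g_odd|g_even] := boolP (odd g).
  have XY : a ^+ g - - b ^+ g = (anorm g)%:R.
    by rewrite opprK -(lucasE _ ab1 abN1) /anorm g_odd addn0.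
  suff h : Q%:R ^+ 2 / q%:R ^+ 3 \in Aint.
    move: h; apply/negP; apply: (@geom_quotient_cube q (a ^+ g) (- b ^+ g)) => //;
      rewrite ?rpredN ?rpredX //.
    - by rewrite mulrN -exprMn abN1 -signr_odd g_odd expr1 opprK expr1n.
    - by rewrite -subr_eq0 XY.
    - rewrite XY -natrM -eQ [in RHS]/anorm oddM g_odd q_odd addn0.
      rewrite (lucasE _ ab1 abN1) -exprM exprNn -signr_odd q_odd -exprM mulnC.
      by rewrite expr1; ring.
    - rewrite XY ek natrM (_ : _ / _ = k%:R ^+ 2 * q%:R); last by field.
      by rewrite rpredM ?rpredX ?rpred_nat.
    have -> : q.-1 = (2 + (q - 3))%N by lia.
    rewrite XY exprD ek natrM (_ : _ / _ = k%:R ^+ 2 * (k%:R * q%:R) ^+ (q - 3)).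
      by rewrite !(rpredM, rpredX) ?rpred_nat.
    by field.
  rewrite {1}expr2 -mulrA {2}ej natrM natrX (_ : _ / _ = j%:R); last by field.
  by rewrite -natrM rpred_nat.
have eg : g = (g./2 * 2)%N by rewrite muln2 even_halfK.
set m := g./2 in eg; pose e : algC := (-1) ^+ m.
have ee : e * e = 1 by rewrite -expr2 sqrr_sign.
have en n : odd n -> e ^+ n = e.
  by move=> n_odd; rewrite /e -exprM mulnC exprM -(signr_odd _ n) n_odd expr1.
have sq n : odd n ->
    ((a ^+ m) ^+ n - (- e * b ^+ m) ^+ n) ^+ 2 = (anorm (n * g))%:R.
  move=> n_odd; rewrite /anorm natrD (lucasE _ ab1 abN1) oddM (negbTE g_even) andbF.
  have -> : (- e * b ^+ m) ^+ n = - (e * (b ^+ m) ^+ n).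
    by rewrite [LHS]exprMn exprNn -signr_odd n_odd expr1 (en _ n_odd); ring.
  rewrite eg.
  rewrite mulnA (mulnC n m) !exprM.
  set x := (a ^+ m) ^+ n; set y := (b ^+ m) ^+ n.
  have xy : x * y = e by rewrite /x /y -!exprMn abN1 -/e en.
  have -> : (x - - (e * y)) ^+ 2 = x ^+ 2 + e * (x * y) *+ 2 + (e * e) * y ^+ 2.
    by ring.
  by rewrite xy ee mul1r /= addrAC.
have sg : (a ^+ m - - e * b ^+ m) ^+ 2 = (anorm g)%:R.
  by rewrite -[in RHS](mul1n g) -(sq 1%N) // !expr1.
have s0 : a ^+ m - - e * b ^+ m != 0 by rewrite -sqrf_eq0 sg.
pose R := ((a ^+ m) ^+ q - (- e * b ^+ m) ^+ q) / (a ^+ m - - e * b ^+ m).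
have RQ : R ^+ 2 = Q%:R.
  by rewrite /R expr_div_n sq // sg eQ natrM mulrAC divff // mul1r.
suff h : R ^+ 2 / q%:R ^+ 3 \in Aint.
  have eA : e \in Aint by rewrite rpredX ?rpredN ?rpred1.
  move: h; apply/negP.
  apply: (@geom_quotient_cube q (a ^+ m) (- e * b ^+ m)) => //.
  - by rewrite rpredX.
  - by apply: rpredM; [rewrite rpredN | rewrite rpredX].
  - rewrite mulrCA -exprMn abN1 -/e.
    by have -> : (- e * e) ^+ 2 = (e * e) ^+ 2 by [ring]; rewrite ee expr1n.
  - by rewrite -subr_eq0.
  - by rewrite [RHS]mulrC divfK.
  - by rewrite sg ek natrM mulfK ?rpred_nat.
  (* The power [q.-1] of the difference must carry [q ^ 2], while its square is only known to carry
     [q]: for [q >= 5] a fourth power is available, for [q = 3] divisibility by 9 is needed. *)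
  have [q3e|q3e] := eqVneq q 3%N.
    have /dvdnP[k' ek'] : (9 %| anorm g)%N by apply: dvdn3_anorm; rewrite -q3e.
    rewrite q3e sg ek' natrM (_ : _ / _ = k'%:R) ?rpred_nat //; by field.
  have -> : q.-1 = (2 * 2 + (q - 5))%N.
    by move: q_odd q3 q3e; case: (q) => [|[|[|[|[|]]]]] //; lia.
  rewrite exprD exprM sg ek natrM.
  rewrite (_ : _ / _ = k%:R ^+ 2 * (a ^+ m - - e * b ^+ m) ^+ (q - 5)); last by field.
  by rewrite rpredM ?rpredX ?rpred_nat ?rpredB ?rpredX //;
    apply: rpredM; [rewrite rpredN | rewrite rpredX].
by rewrite RQ ej natrM natrX mulfK ?expf_neq0 ?rpred_nat.
Qed.

End Lifting.

(** * Indices bringing no new prime divisor except 5 *)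

Lemma dvdn5_anorm_oddmul q g : odd q ->
  5 %| anorm (q * g) -> 5 %| anorm g.
Proof.
rewrite !dvdn5_anorm -modnMm => q_odd.
have : odd (q %% 4) by rewrite odd_mod.
have : q %% 4 < 4 by rewrite ltn_mod.
have : g %% 4 < 4 by rewrite ltn_mod.
by case: (q %% 4) => [|[|[|[|]]]] //; case: (g %% 4) => [|[|[|[|]]]].
Qed.

Lemma anorm_quotient_primary q g Q : prime q -> odd q -> 0 < g ->
  anorm (q * g) = anorm g * Q ->
  (forall p, prime p -> p %| Q -> p %| anorm g) -> (q, g) = (5, 2).
Proof.
move=> q_pr q_odd g0 eQ hQ.
have Q0 : 0 < Q by move: (anorm_gt0 (q * g)); rewrite eQ; case: (Q); rewrite ?muln0.
have /p_natP[i ei] : q.-nat Q.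
  apply/pnatP => // p p_pr pQ.
  by have -> := dvdn_anorm_quotient p_pr q_pr q_odd g0 eQ (hQ p p_pr pQ) pQ; rewrite !inE.
have i3 : i < 3.
  rewrite ltnNge; apply/negP => i3.
  have := anorm_quotient_ncube q_pr q_odd g0 eQ; rewrite ei dvdn_exp2l // => h.
  suff /h : q %| anorm g by [].
  by apply: hQ; rewrite // ei dvdn_exp //; case: (i) i3.
have := @anorm_small q g q_pr q_odd g0; rewrite eQ mulnC leq_mul2r {1}ei.
rewrite leq_pexp2l ?prime_gt0 // orbT => /(_ isT).
(* The quotients of the five pairs are 4, 4, 11, 25 and 29; only 25, for [(5, 2)], is a power of its
   [q]. *)
by rewrite !inE => /or4P[| | | /orP[]] /eqP[eq1 eq2] //;
   move: eQ; rewrite ei eq1 eq2; case: i i3 {ei} => [|[|[|]]].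
Qed.

Lemma dvdn_anorm_lower t1 t2 : 0 < t1 -> t1 < t2 ->
  (forall p, prime p -> p != 5 -> p %| anorm t2 -> p %| anorm t1) ->
  t2 \in [:: 2; 6; 10].
Proof.
move=> t10 t12 H; have t20 : 0 < t2 by apply: leq_trans t12.
have M0 := anorm_gt0 t2.
have main q g : prime q -> odd q -> t2 = q * g ->
    (forall p, prime p -> p != 5 -> p %| anorm t2 -> p %| anorm g) -> t2 = 10.
  move=> q_pr q_odd et hp; have [Q [eQ _]] := anorm_quotient g q_odd.
  have g0 : 0 < g by move: t20; rewrite et muln_gt0 => /andP[].
  suff [eq eg] : (q, g) = (5, 2) by rewrite et eq eg.
  apply: (anorm_quotient_primary q_pr q_odd g0 eQ) => p p_pr pQ.
  have pM : p %| anorm t2 by rewrite et eQ dvdn_mull.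
  (* The hypothesis is silent on 5, but 5 passes down to [anorm g] because [q] is odd. *)
  have [p5|p5] := eqVneq p 5; last exact: hp.
  by rewrite p5; apply: (@dvdn5_anorm_oddmul q) => //; rewrite -et -p5.
have [/hasP[p]|/hasPn noprime] :=
    boolP (has (fun p => (p != 2) && (p != 5)) (primes (anorm t2))).
  rewrite mem_primes => /and3P[p_pr _ pM] /andP[p2 p5].
  (* A prime divisor other than 2 and 5 makes [t2 %/ g] odd; as [t1 < t2] it exceeds 1, so it has an
     odd prime factor. *)
  have [_ /(_ p2) d_odd] := dvdn_anorm_gcd p_pr t10 (H _ p_pr p5 pM) pM.
  set g := gcdn t1 t2 in d_odd; set d := t2 %/ g in d_odd.
  have dg : d * g = t2 by rewrite divnK ?dvdn_gcdr.
  have gt1 : g <= t1 by rewrite dvdn_leq ?dvdn_gcdl.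
  have d1 : 1 < d by move: t12; rewrite -dg; case: (d) => [|[|]] //; lia.
  have qd := pdiv_dvd d; have q_odd := dvdn_odd qd d_odd.
  have e_odd : odd (d %/ pdiv d) by apply: dvdn_odd d_odd; rewrite dvdn_div.
  suff -> : t2 = 10 by [].
  apply: (main (pdiv d) (d %/ pdiv d * g)); rewrite ?pdiv_prime //.
    by rewrite mulnA [pdiv d * _]mulnC divnK.
  move=> r r_pr r5 rM; apply: dvdn_anorm_oddmul => //.
  by case: (dvdn_anorm_gcd r_pr t10 (H _ r_pr r5 rM) rM).
have prime25 p : prime p -> p %| anorm t2 -> p = 2 \/ p = 5.
  move=> p_pr pM; have := noprime p; rewrite mem_primes p_pr M0 pM => /(_ isT).
  by rewrite negb_and !negbK => /orP[]/eqP; [left|right].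
have [/hasP[q]|/hasPn noodd] := boolP (has odd (primes t2)).
  rewrite mem_primes => /and3P[q_pr _ /dvdnP[g]]; rewrite mulnC => et q_odd.
  have [q3|q3] := eqVneq q 3; last first.
    suff -> : t2 = 10 by [].
    (* Only [p = 2] is left; [2 %| anorm n] means [3 %| n], which survives removing a prime factor
       other than 3. *)
    apply: (main q g) => // p p_pr p5 pM.
    have [p2|/eqP] := prime25 p p_pr pM; last by rewrite (negbTE p5).
    move: pM; rewrite p2 !dvdn2_anorm et Euclid_dvdM // dvdn_prime2 //.
    by rewrite eq_sym (negbTE q3).
  have [Q [eQ _]] := anorm_quotient g q_odd.
  have g0 : 0 < g by move: t20; rewrite et muln_gt0 => /andP[].
  have QM : Q %| anorm t2 by rewrite et eQ dvdn_mull.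
  have Q0 : 0 < Q by apply: dvdn_gt0 QM.
  (* A factor 5 of [Q] would equal [q = 3]. So [Q] is a power of 2, below 8 by [ndvdn8_anorm]. *)
  have /p_natP[i ei] : 2.-nat Q.
    apply/pnatP => // p p_pr pQ.
    have [-> //|p5] := prime25 p p_pr (dvdn_trans pQ QM).
    have : 5 = q; last by rewrite q3.
    apply: (dvdn_anorm_quotient _ q_pr q_odd g0 eQ); rewrite -?p5 //.
    by rewrite p5; apply: (@dvdn5_anorm_oddmul q) => //; rewrite -et -p5 (dvdn_trans pQ).
  have i3 : i < 3.
    rewrite ltnNge; apply: contra (ndvdn8_anorm t2) => i3.
    by apply: dvdn_trans QM; rewrite ei (@dvdn_exp2l 2 3).
  have := @anorm_small q g q_pr q_odd g0; rewrite eQ [_ * Q]mulnC leq_mul2r ei q3.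
  rewrite (@leq_trans (2 ^ 2)) ?leq_pexp2l // orbT => /(_ isT).
  rewrite et q3 !inE => /or4P[| | | /orP[]] /eqP[eq2] //; rewrite eq2 //.
  (* [t2 = 3] is excluded: [anorm 3 = 4] is even, while [anorm 1] and [anorm 2] are odd. *)
  have := H 2 isT isT; rewrite et q3 eq2 => /(_ isT).
  by move: t10 t12; rewrite et q3 eq2; case: (t1) => [|[|[|]]].
have /p_natP[k ek] : 2.-nat t2.
  apply/pnatP => // p p_pr pt; have := noodd p; rewrite mem_primes p_pr t20 pt.
  by move=> /(_ isT); case: (even_prime p_pr) => [-> //|->].
case: k ek => [|[|k]] ek; first by move: t10 t12; rewrite ek; case: (t1).
  by rewrite ek.
have t21 : 1 < t2 by rewrite ek (@leq_exp2l 2 1).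
(* A power of 2 that is a multiple of 4 makes [anorm t2] prime to 2 and to 5, although it exceeds
   1. *)
have [p2|p5] := prime25 _ (pdiv_prime (anorm_gt1 t21)) (pdiv_dvd _).
  have := pdiv_dvd (anorm t2); rewrite p2 dvdn2_anorm ek Euclid_dvdX //.
have := pdiv_dvd (anorm t2); rewrite p5 dvdn5_anorm ek !expnS mulnA.
by rewrite modnMr.
Qed.

(** Compared with [t1 = 1], the condition on primes other than 5 is vacuous; among 2, 6, 10 the
    index 6 drops out since [anorm 6 = 20]. *)
Lemma anorm_pow5 t : 0 < t -> 5.-nat (anorm t) -> t \in [:: 1; 2; 10].
Proof.
move=> t0 h5; have [-> //|t1] := eqVneq t 1.
have : t \in [:: 2; 6; 10].
  apply: (@dvdn_anorm_lower 1) => [//||p p_pr p5 pM]; first by lia.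
  by move/(pnatP _ (anorm_gt0 t)): h5 => /(_ p p_pr pM); rewrite inE /= (negbTE p5).
rewrite !inE => /or3P[] /eqP et; rewrite et //.
by move: h5; rewrite et.
Qed.

(** * From multiplicative relations to valuations *)

Section Relations.
Local Open Scope ring_scope.

Lemma sqrt5_neq0 : sqrt5 != 0.
Proof. by rewrite sqrtC_eq0 pnatr_eq0. Qed.

Lemma sqrt5_alpha : sqrt5 = alpha *+ 2 - 1.
Proof. by rewrite /alpha; field. Qed.

Lemma sqr_alpha : alpha ^+ 2 = alpha + 1.
Proof.
have -> : alpha ^+ 2 = alpha - alpha * (1 - alpha) by ring.
by rewrite alpha_conj opprK.
Qed.

Lemma alpha_gt1 : 1 < alpha.
Proof.
rewrite /alpha ltr_pdivlMr ?ltr0n // mul1r -[2%:R]/(1 + 1) ltrD2l.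
by rewrite -[X in X < _]sqrtC1 ltr_sqrtC ?qualifE /= ?ler0n ?ler01 // ltr1n.
Qed.

Lemma alpha_neq0 : alpha != 0.
Proof. by rewrite gt_eqF // (lt_trans ltr01 alpha_gt1). Qed.

Lemma tau_neq0 t : tau t != 0.
Proof.
rewrite mulf_neq0 ?invr_eq0 ?sqrt5_neq0 // gt_eqF // addr_gt0 ?ltr01 //.
by rewrite exprn_gt0 // (lt_trans ltr01 alpha_gt1).
Qed.

Lemma alpha_expz_eq1 (a : int) : alpha ^ a = 1 -> a = 0.
Proof.
have main n : alpha ^+ n = 1 -> n = 0%N.
  case: n => // n h; have : 1 < alpha ^+ n.+1 by rewrite exprn_egt1 ?alpha_gt1.
  by rewrite h ltxx.
case: a => n; first by move/main ->.
by rewrite NegzE -exprnN => /(congr1 GRing.inv); rewrite invrK invr1 => /main.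
Qed.

(* [z + z ^+ 4] and [z ^+ 2 + z ^+ 3] are the roots of [X ^+ 2 + X - 1], and
   squaring the fifth roots of unity exchanges them. *)
Lemma sqrt5_conj : exists u : {rmorphism algC -> algC}, u sqrt5 = - sqrt5.
Proof.
have [z z_prim] := @C_prim_root_exists 5 isT.
have [u hu] := @Qn_aut_exists 2 5 isT; exists u.
have z5 : z ^+ 5 = 1 := prim_expr_order z_prim.
have z1 : z != 1 by have := eq_prim_root_expr z_prim 1 0; rewrite expr1 expr0 => ->.
have sum0 : 1 + z + z ^+ 2 + z ^+ 3 + z ^+ 4 = 0.
  have z10 : z - 1 != 0 by rewrite subr_eq0.
  apply: (mulfI z10); rewrite mulr0; apply: (@etrans _ _ (z ^+ 5 - 1)); first by ring.
  by rewrite z5 subrr.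
pose w := z + z ^+ 4.
have ew : w ^+ 2 = 1 - w.
  have -> : w ^+ 2 = z ^+ 2 + z ^+ 5 *+ 2 + z ^+ 5 * z ^+ 3 by rewrite /w; ring.
  rewrite z5 -[RHS](addr0) -sum0 /w; ring.
have uw : u w = - 1 - w.
  rewrite /w rmorphD rmorphXn /= hu // -exprM (exprD z 5 3) z5 mul1r.
  by rewrite -[LHS](subr0) -sum0; ring.
have : sqrt5 ^+ 2 = (w *+ 2 + 1) ^+ 2.
  have -> : (w *+ 2 + 1) ^+ 2 = w ^+ 2 * 4%:R + w * 4%:R + 1 by ring.
  by rewrite sqr_sqrt5 ew; ring.
move/eqP; rewrite eqf_sqr => /orP[] /eqP ->;
  rewrite ?rmorphN rmorphD rmorphMn rmorph1 /= uw; ring.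
Qed.

(** Adding a large [N] to the three exponents turns the relation into an equation between natural
    numbers, whose valuations can be compared. *)
Lemma logn_relation (A B C : nat) (x y z : int) : (0 < A)%N -> (0 < B)%N ->
  (0 < C)%N -> A%:R ^ x * B%:R ^ y * C%:R ^ z = 1 :> algC ->
  forall p, x * (logn p A)%:Z + y * (logn p B)%:Z + z * (logn p C)%:Z = 0.
Proof.
move=> A0 B0 C0 h p.
pose N := (`|x| + `|y| + `|z|)%N.
have shift (D : nat) (e : int) : (0 < D)%N -> (`|e| <= N)%N ->
    D%:R ^ e * D%:R ^+ N = D%:R ^+ `|e + N%:Z| :> algC.
  move=> D0 eN; rewrite !exprnP -expfzDr ?pnatr_eq0 -?lt0n //.
  by congr (_ ^ _); lia.
pose x' := absz (x + N%:Z); pose y' := absz (y + N%:Z); pose z' := absz (z + N%:Z).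
have : (A ^ x' * B ^ y' * C ^ z' = (A * B * C) ^ N)%N.
  apply/eqP; rewrite -(eqr_nat algC) natrM natrM !natrX natrM natrM.
  rewrite -(shift _ x) // -?(shift _ y) // -?(shift _ z) //; try by rewrite /N; lia.
  move: (A%:R ^ x) (B%:R ^ y) (C%:R ^ z) h => A' B' C' h.
  apply/eqP; rewrite !exprMn.
  set AN := _ ^+ N; set BN := _ ^+ N; set CN := _ ^+ N.
  have -> : A' * AN * (B' * BN) * (C' * CN) = A' * B' * C' * (AN * BN * CN) by ring.
  by rewrite h mul1r.
have ex : x'%:Z = x + N%:Z by rewrite /x' /N; lia.
have ey : y'%:Z = y + N%:Z by rewrite /y' /N; lia.
have ez : z'%:Z = z + N%:Z by rewrite /z' /N; lia.
move/(congr1 (logn p)).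
rewrite !(lognM, lognX) ?(muln_gt0, expn_gt0) ?A0 ?B0 ?C0 //.
move: (logn p A) (logn p B) (logn p C) => a b c.
move/(congr1 Posz); rewrite !PoszD !PoszM !PoszD ex ey ez => {}h.
have -> : x * a%:Z + y * b%:Z + z * c%:Z =
  ((x + N%:Z) * a%:Z + (y + N%:Z) * b%:Z + (z + N%:Z) * c%:Z) -
  N%:Z * (a%:Z + b%:Z + c%:Z) by ring.
by rewrite h subrr.
Qed.

(* Multiply a relation with its conjugate and square, to get rid of signs. *)
Lemma logn_tau_relation (t1 t2 : nat) (a s b c : int) :
  alpha ^ a * sqrt5 ^ s * tau t1 ^ b * tau t2 ^ c = 1 ->
  forall p, b * (logn p (anorm t1))%:Z + c * (logn p (anorm t2))%:Z =
            (b + c - s) * (logn p 5)%:Z.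
Proof.
move=> h p; have [u u5] := sqrt5_conj.
pose n x := (x * u x) ^+ 2.
have nM x y : n (x * y) = n x * n y by rewrite /n rmorphM /=; ring.
have nX x (k : int) : n (x ^ k) = n x ^ k.
  by rewrite /n fmorphXz -expfzMl !exprnP !exprz_exp [k * _]mulrC.
have ualpha : u alpha = 1 - alpha.
  by rewrite /alpha fmorph_div rmorphD rmorph1 u5 rmorph_nat; field.
have nalpha : n alpha = 1 by rewrite /n ualpha alpha_conj sqrrN expr1n.
have n5 : n sqrt5 = 25%:R.
  rewrite /n u5; have -> : (sqrt5 * - sqrt5) ^+ 2 = (sqrt5 ^+ 2) ^+ 2 by ring.
  by rewrite sqr_sqrt5; ring.
have s50 := sqrt5_neq0.
have ntau t : n (tau t) = (anorm t ^ 2)%:R * 25%:R^-1.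
  have -> : 25%:R^-1 = (sqrt5 * - sqrt5)^-1 ^+ 2 :> algC.
    by rewrite -n5 /n u5 exprVn.
  rewrite natrX (anormE t (_ : alpha + (1 - alpha) = 1) alpha_conj); last by ring.
  rewrite /n /tau fmorph_div rmorphD rmorphXn /= ualpha u5 rmorph1.
  by field; rewrite s50.
have := congr1 n h; rewrite !nM !nX nalpha n5 !ntau.
rewrite [n 1](_ : _ = 1); last by rewrite /n rmorph1 mulr1 expr1n.
rewrite exp1rz mul1r => {}h.
have {}h : 25%:R ^ (s - b - c) * (anorm t1 ^ 2)%:R ^ b * (anorm t2 ^ 2)%:R ^ c = 1 :> algC.
  move: h; rewrite !expfzMl !exprz_inv !expfzDr ?pnatr_eq0 // => h.
  rewrite -[RHS]h; ring.
have := @logn_relation 25 (anorm t1 ^ 2) (anorm t2 ^ 2) _ _ _ isT _ _ h p.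
rewrite !expn_gt0 !anorm_gt0 => /(_ isT isT).
rewrite (lognX p 5 2) !lognX !PoszM; move: (logn p 5) (logn p _) (logn p _) => x y z.
lia.
Qed.

End Relations.

(** * Independence and the exceptional relations *)

Section Independence.
Local Open Scope ring_scope.

Lemma mult_indep2 (x y : algC) : mult_indep [tuple x; y] <->
  [/\ x != 0, y != 0 & forall a b : int, x ^ a * y ^ b = 1 -> a = 0 /\ b = 0].
Proof.
split=> [[h0 h]|[x0 y0 h]].
  split=> [||a b hab]; first exact: (h0 ord0).
    exact: (h0 (lift ord0 ord0)).
  have {}h := h (tnth [tuple a; b]); rewrite !big_ord_recl big_ord0 mulr1 in h.
  by have {}h := h hab; split; [exact: (h ord0) | exact: (h (lift ord0 ord0))].
split=> [i|e].
  by case: i => [[|[|i]] lti] //; rewrite (tnth_nth 0).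
rewrite !big_ord_recl big_ord0 mulr1 => /h[e0 e1] i.
by case: (unliftP ord0 i) => [j ->|-> //]; rewrite [j]ord1.
Qed.

Lemma mult_indep3 (x y z : algC) : mult_indep [tuple x; y; z] <->
  [/\ x != 0, y != 0, z != 0 & forall a b c : int,
     x ^ a * y ^ b * z ^ c = 1 -> [/\ a = 0, b = 0 & c = 0]].
Proof.
split=> [[h0 h]|[x0 y0 z0 h]].
  split=> [|||a b c habc]; first exact: (h0 ord0).
  - exact: (h0 (lift ord0 ord0)).
  - exact: (h0 (lift ord0 (lift ord0 ord0))).
  have {}h := h (tnth [tuple a; b; c]).
  rewrite !big_ord_recl big_ord0 mulr1 mulrA in h; have {}h := h habc.
  split; [exact: (h ord0) | exact: (h (lift ord0 ord0)) |].
  exact: (h (lift ord0 (lift ord0 ord0))).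
split=> [i|e].
  by case: i => [[|[|[|i]]] lti] //; rewrite (tnth_nth 0).
rewrite !big_ord_recl big_ord0 mulr1 mulrA => /h[e0 e1 e2] i.
case: (unliftP ord0 i) => [j ->|-> //]; case: (unliftP ord0 j) => [k ->|-> //].
by rewrite [k]ord1.
Qed.

Lemma tau1E : tau 1 = alpha ^+ 2 / sqrt5.
Proof. by rewrite /tau expr1 sqr_alpha. Qed.

Lemma tau2E : tau 2 = alpha.
Proof.
apply: (mulIf sqrt5_neq0); rewrite divfK ?sqrt5_neq0 // sqrt5_alpha.
have -> : alpha * (alpha *+ 2 - 1) = alpha ^+ 2 *+ 2 - alpha by ring.
by rewrite sqr_alpha; ring.
Qed.

Lemma tau10E : tau 10 = sqrt5 ^+ 2 * alpha ^+ 5.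
Proof.
have a5 : alpha ^+ 5 = alpha *+ 5 + 3%:R.
  have -> : alpha ^+ 5 = alpha ^+ 2 * alpha ^+ 2 * alpha by ring.
  rewrite sqr_alpha.
  have -> : (alpha + 1) * (alpha + 1) * alpha =
     alpha ^+ 2 * alpha + alpha ^+ 2 *+ 2 + alpha by ring.
  rewrite sqr_alpha; have -> : (alpha + 1) * alpha = alpha ^+ 2 + alpha by ring.
  by rewrite sqr_alpha; ring.
apply: (mulIf sqrt5_neq0); rewrite divfK ?sqrt5_neq0 // sqr_sqrt5.
rewrite (exprM alpha 5 2) a5 sqrt5_alpha.
have -> : (alpha *+ 5 + 3%:R) ^+ 2 = alpha ^+ 2 *+ 25 + alpha *+ 30 + 9%:R by ring.
have -> : 5%:R * (alpha *+ 5 + 3%:R) * (alpha *+ 2 - 1) =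
  alpha ^+ 2 *+ 50 + alpha *+ 5 - 15%:R by ring.
by rewrite sqr_alpha; ring.
Qed.

Lemma tau1_tau10 : tau 1 ^+ 2 * tau 10 = alpha ^+ 9.
Proof. by rewrite tau1E tau10E; field; rewrite sqrt5_neq0. Qed.

(** A nonzero [b] cancels and leaves [anorm t = 5], which holds only at [t = 2]. *)
Lemma logn_eq5 t (b : int) : (0 < t)%N -> t <> 2%N ->
  (forall p, b * (logn p (anorm t))%:Z = b * (logn p 5)%:Z) -> b = 0.
Proof.
move=> t0 t2 h; apply/eqP; apply/negPn/negP => b0.
have M5 : anorm t = 5%N.
  apply: eqn_from_log => //; first exact: anorm_gt0.
  by move=> p; apply/eqP; rewrite -eqz_nat; apply/eqP/(mulfI b0).
have := @anorm_pow5 t t0; rewrite M5 => /(_ isT).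
by rewrite !inE => /or3P[] /eqP et; move: M5 t2; rewrite et.
Qed.

Lemma logn_other5 p : p != 5%N -> logn p 5 = 0%N.
Proof. by rewrite logn_prime // => /negbTE ->. Qed.

Lemma pow5_of_logn t (c : int) : c != 0 ->
  (forall p, p != 5%N -> c * (logn p (anorm t))%:Z = 0) -> (5%N).-nat (anorm t).
Proof.
move=> c0 h; apply/(pnatP _ (anorm_gt0 t)) => p p_pr pM; rewrite inE /=.
apply/negPn/negP => /h /eqP; rewrite mulf_eq0 (negbTE c0) /= eqz_nat.
by rewrite -[_ == _]negbK -lt0n logn_gt0 mem_primes p_pr anorm_gt0 pM.
Qed.

(** At primes other than 5 the right side vanishes, so if [c != 0] each such prime dividing
    [anorm t2] divides [anorm t1], and [dvdn_anorm_lower] leaves three values of [t2]. *)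
Lemma logn_tau_pair t1 t2 (b c : int) : (0 < t1)%N -> (t1 < t2)%N ->
  ~ (t1 = 2%N \/ t2 = 2%N \/ (t1, t2) = (1%N, 10%N)) ->
  (forall p, b * (logn p (anorm t1))%:Z + c * (logn p (anorm t2))%:Z =
             (b + c) * (logn p 5)%:Z) -> b = 0 /\ c = 0.
Proof.
move=> t10 t12 ne h.
have [c0|c0] := eqVneq c 0.
  split=> //; apply: (@logn_eq5 t1) => // [t1_2|p]; first by apply: ne; left.
  by have := h p; rewrite c0 mul0r !addr0.
have : t2 \in [:: 2; 6; 10]%N.
  apply: (dvdn_anorm_lower t10 t12) => p p_pr p5 pM2; apply/negPn/negP => pM1.
  have := h p; rewrite (logn_other5 p5) mulr0 (lognE p (anorm t1)).
  rewrite p_pr anorm_gt0 (negbTE pM1) mulr0 add0r => /eqP.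
  rewrite mulf_eq0 (negbTE c0) /= eqz_nat -[_ == _]negbK -lt0n logn_gt0.
  by rewrite mem_primes p_pr anorm_gt0 pM2.
rewrite !inE => /or3P[] /eqP et.
- by case: ne; right; left.
- have [b0|b0] := eqVneq b 0.
    have := h 2%N; rewrite et b0 (_ : logn 2 (anorm 6) = 2) // (_ : logn 2 5 = 0%N) //.
    by lia.
  (* [anorm 6 = 20]. For [t1] among 1, 4, 5 the number [anorm t1] is odd and the prime 2 forces
     [c = 0]; for [t1 = 3] the prime 5 forces [b = 0]. *)
  move: (h 2%N) (h 5%N) t12; rewrite et.
  rewrite (_ : logn 2 5 = 0%N) // (_ : logn 5 5 = 1%N) //.
  rewrite (_ : logn 2 (anorm 6) = 2) // (_ : logn 5 (anorm 6) = 1%N) //.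
  case: t1 t10 ne {h} => [|[|[|[|[|[|t1]]]]]] // _ ne.
  + rewrite (_ : logn 2 (anorm 1) = 0%N) //; lia.
  + by case: ne; left.
  + rewrite (_ : logn 2 (anorm 3) = 2%N) // (_ : logn 5 (anorm 3) = 0%N) //; lia.
  + rewrite (_ : logn 2 (anorm 4) = 0%N) //; lia.
  + rewrite (_ : logn 2 (anorm 5) = 0%N) //; lia.
have [b0|b0] := eqVneq b 0.
  have := h 5%N; rewrite et b0 (_ : logn 5 (anorm 10) = 3) //.
  rewrite (_ : logn 5 5 = 1%N) //; lia.
have : t1 \in [:: 1; 2; 10]%N.
  apply: anorm_pow5 => //; apply: (pow5_of_logn b0) => p p5; have := h p.
  rewrite et (_ : anorm 10 = 5 ^ 3)%N // lognX (logn_other5 p5).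
  by rewrite muln0 !mulr0 addr0.
rewrite !inE => /or3P[] /eqP et1; case: ne; rewrite et et1; [by right; right|by left|].
by move: t12; rewrite et et1.
Qed.

Lemma alpha_tau_indep t (a b : int) : (0 < t)%N -> t <> 2%N ->
  alpha ^ a * tau t ^ b = 1 -> a = 0 /\ b = 0.
Proof.
move=> t0 t2 h; have b0 : b = 0.
  apply: (@logn_eq5 t) => // p.
  have := @logn_tau_relation t t a 0 b 0.
  by rewrite !expr0z !mulr1 h => /(_ erefl p); rewrite mul0r !addr0 ?subr0.
by move: h; rewrite b0 expr0z mulr1 => /alpha_expz_eq1.
Qed.

Lemma alpha_tau_tau_indep t1 t2 (a b c : int) : (0 < t1)%N -> (t1 < t2)%N ->
  ~ (t1 = 2%N \/ t2 = 2%N \/ (t1, t2) = (1%N, 10%N)) ->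
  alpha ^ a * tau t1 ^ b * tau t2 ^ c = 1 -> [/\ a = 0, b = 0 & c = 0].
Proof.
move=> t10 t12 ne h; have [b0 c0] : b = 0 /\ c = 0.
  apply: (logn_tau_pair t10 t12 ne) => p.
  have := @logn_tau_relation t1 t2 a 0 b c.
  by rewrite expr0z mulr1 h => /(_ erefl p); rewrite subr0.
by move: h; rewrite b0 c0 !expr0z !mulr1 => /alpha_expz_eq1.
Qed.

Lemma tau_tau_indep t1 t2 (b c : int) : (0 < t1)%N -> (t1 < t2)%N ->
  tau t1 ^ b * tau t2 ^ c = 1 -> b = 0 /\ c = 0.
Proof.
move=> t10 t12 h.
have [t1_2|t1_2] := eqVneq t1 2%N.
  move: h; rewrite t1_2 tau2E => /alpha_tau_indep; apply.
    exact: leq_trans t12.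
  by move=> t2_2; move: t12; rewrite t1_2 t2_2.
have [t2_2|t2_2] := eqVneq t2 2%N.
  move: h; rewrite t2_2 tau2E mulrC => /alpha_tau_indep h.
  by have [-> ->] := h t10 (elimN eqP t1_2).
have [/eqP[e1 e2]|ne] := boolP ((t1, t2) == (1%N, 10%N)); last first.
  have [] // := @alpha_tau_tau_indep t1 t2 0 b c t10 t12.
    by case=> [/eqP|[/eqP|/eqP]]; apply/negP.
  by rewrite expr0z mul1r.
(* For the pair [(1, 10)] the prime 5 gives [3c = b + c], and the relation becomes a power of
   [tau1_tau10]. *)
have bc : b = c *+ 2.
  have := @logn_tau_relation t1 t2 0 0 b c; rewrite !expr0z !mul1r h.
  move=> /(_ erefl 5%N); rewrite e1 e2 (_ : logn 5 (anorm 10) = 3) //.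
  rewrite (_ : logn 5 (anorm 1) = 0%N) // (_ : logn 5 5 = 1%N) //; lia.
have c0 : c = 0.
  have : alpha ^ (9%:Z * c) = 1.
    rewrite -h e1 e2 bc -mulr_natl -!exprz_exp -expfzMl -!exprnP tau1_tau10.
    by [].
  by move/alpha_expz_eq1; lia.
by rewrite bc c0.
Qed.

Lemma alpha_sqrt5_tau_indep t (a s c : int) : (0 < t)%N ->
  ~ (t = 1%N \/ t = 2%N \/ t = 10%N) ->
  alpha ^ a * sqrt5 ^ s * tau t ^ c = 1 -> [/\ a = 0, s = 0 & c = 0].
Proof.
move=> t0 ne h.
have rel p : c * (logn p (anorm t))%:Z = (c - s) * (logn p 5)%:Z.
  have := @logn_tau_relation t t a s 0 c.
  by rewrite expr0z mulr1 h => /(_ erefl p); rewrite mul0r !add0r.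
have c0 : c = 0.
  apply/eqP; apply/negPn/negP => c0; case: ne.
  have : t \in [:: 1; 2; 10]%N.
    apply: anorm_pow5 => //; apply: (pow5_of_logn c0) => p p5.
    by rewrite rel (logn_other5 p5) mulr0.
  by rewrite !inE => /or3P[] /eqP ->; auto.
have s0 : s = 0.
  by have := rel 5%N; rewrite c0 (_ : logn 5 5 = 1%N) //; lia.
by move: h; rewrite c0 s0 !expr0z !mulr1 => /alpha_expz_eq1.
Qed.

End Independence.

Theorem theorem4p1 (t t1 t2 : nat)
    (ht : (0 < t)%N) (ht1 : (0 < t1)%N) (ht12 : (t1 < t2)%N) :
  (mult_indep [tuple alpha; tau t] <-> t <> 2%N) /\
  mult_indep [tuple tau t1; tau t2] /\
  (mult_indep [tuple alpha; tau t1; tau t2] <->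
     ~ (t1 = 2%N \/ t2 = 2%N \/ (t1, t2) = (1%N, 10%N))) /\
  (mult_indep [tuple alpha; sqrt5; tau t] <->
     ~ (t = 1%N \/ t = 2%N \/ t = 10%N)).
Proof.
have a0 := alpha_neq0; have s0 := sqrt5_neq0.
split; [|split; [|split]].
- rewrite mult_indep2; split=> [[_ _ h] t_2|t_2].
    by have := h 1%R (-1)%R; rewrite t_2 tau2E -expfzDr // => /(_ erefl)[].
  split=> // [|a b]; first exact: tau_neq0.
  exact: alpha_tau_indep.
- apply/mult_indep2; split; try exact: tau_neq0.
  by move=> b c; exact: tau_tau_indep.
- rewrite mult_indep3; split=> [[_ _ _ h]|ne].
    case=> [e|[e|[e1 e2]]].
    + have := h 1%R (-1)%R 0%R; rewrite e tau2E expr0z mulr1 -expfzDr //.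
      by move=> /(_ erefl)[].
    + have := h 1%R 0%R (-1)%R; rewrite e tau2E expr0z mulr1 -expfzDr //.
      by move=> /(_ erefl)[].
    (* The exponents come from [tau1_tau10]. *)
    have := h (-9)%R 2%R 1%R; rewrite e1 e2 -mulrA expr1z tau1_tau10.
    by rewrite exprnP -expfzDr // => /(_ erefl)[].
  split=> //; try exact: tau_neq0.
  by move=> a b c; exact: alpha_tau_tau_indep.
rewrite mult_indep3; split=> [[_ _ _ h]|ne].
  case=> [e|[e|e]].
  + have := h (-2)%R 1%R 1%R; rewrite e tau1E !expr1z -mulrA [(sqrt5 * _)%R]mulrC divfK //.
    by rewrite exprnP -expfzDr // => /(_ erefl)[].
  + have := h 1%R 0%R (-1)%R; rewrite e tau2E expr0z mulr1 -expfzDr //.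
    by move=> /(_ erefl)[].
  have := h 5%R 2%R (-1)%R; rewrite e exprN1 [(_ ^ 5 * _)%R]mulrC -tau10E.
  by rewrite divff ?tau_neq0 // => /(_ erefl)[].
split=> //; try exact: tau_neq0.
by move=> a b c; exact: alpha_sqrt5_tau_indep.
Qed.
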